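(* Let $\mathfrak g$ be a complex simple Lie algebra such that the highest root $\theta$ is a fundamental weight, and let $\tilde\alpha\in\Pi$ be the unique simple root with $(\theta,\tilde\alpha)\neq 0$. Then $\tilde\alpha(x_{\mathcal K})=-1$ and $(\theta-\tilde\alpha)(x_{\mathcal K})=2$. In particular, $x_{\mathcal K}\in\mathfrak t$ is not dominant.
   Context: Let $\mathfrak g$ be a complex simple Lie algebra, $\mathfrak t$ a Cartan subalgebra, $\Delta$ the root system of $(\mathfrak g,\mathfrak t)$, $\Delta^+$ a fixed set of positive roots, $\Pi$ the corresponding simple roots, $\theta$ the highest root. Let $\mathfrak t^*_{\mathbb Q}$ be the $\mathbb Q$-span of $\Delta$ and $(\ ,\ )$ the positive-definite form on it induced by the Killing form; it is used to identify $\mathfrak t$ and $\mathfrak t^*$. For $\gamma\in\Delta$ put $\gamma^\vee=2\gamma/(\gamma,\gamma)$. Kostant cascade $\mathcal K=\{\beta_1,\dots,\beta_m\}\subset\Delta^+$: it is defined recursively. Its first element is $\beta_1=\theta$. The root system $\Delta_\theta=\{\gamma\in\Delta\mid(\gamma,\theta)=0\}$ is decomposed into irreducible components, each with the set of positive roots inherited from $\Delta^+$; the highest roots of these components are added to $\mathcal K$, and the procedure is repeated for each component until it terminates. The roots in $\mathcal K$ are pairwise strongly orthogonal ($\beta_i\pm\beta_j\notin\Delta$). The cascade element is $x_{\mathcal K}=\sum_{i=1}^m\frac{\beta_i}{(\beta_i,\beta_i)}=\frac12\sum_{i=1}^m\beta_i^\vee\in\mathfrak t$, i.e., the unique element of the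 $\mathbb Q$-span of $\mathcal K$ with $\beta_i(x_{\mathcal K})=1$ for all $i$. An element $x\in\mathfrak t$ is called dominant if $\gamma(x)\ge 0$ for all $\gamma\in\Delta^+$. *)

(* Defs.v *)
From HB Require Import structures.
From mathcomp Require Import all_boot all_order all_algebra.
From mathcomp Require Import all_classical all_reals complex.

Set Implicit Arguments.
Unset Strict Implicit.
Unset Printing Implicit Defensive.

Import GRing.Theory Num.Theory.
Local Open Scope ring_scope.
Local Open Scope classical_set_scope.

HB.mixin Record Vector_isLieAlgebra (K : fieldType) L of Vector K L := {
  bracket : L -> L -> L;
  bracket_linearl : forall (a : K) (x y z : L),
    bracket (a *: x + y) z = a *: bracket x z + bracket y z;
  bracket_linearr : forall (a : K) (x y z : L),
    bracket z (a *: x + y) = a *: bracket z x + bracket z y;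
  bracket_alt : forall x : L, bracket x x = 0;
  bracket_jacobi : forall x y z : L,
    bracket x (bracket y z) + bracket y (bracket z x)
      + bracket z (bracket x y) = 0
}.

(* Finite-dimensional Lie algebras over the field K. *)
#[short(type="lieAlgType")]
HB.structure Definition LieAlgebra (K : fieldType) :=
  {L of Vector K L & Vector_isLieAlgebra K L}.

Definition lie_ideal (K : fieldType) (g : lieAlgType K) (I : {vspace g}) :=
  forall x y : g, y \in I -> bracket x y \in I.

Definition lie_simple (K : fieldType) (g : lieAlgType K) :=
  (exists x y : g, bracket x y != 0) /\
  forall I : {vspace g}, lie_ideal I -> I = 0%VS \/ I = fullv.

Definition ad (K : fieldType) (g : lieAlgType K) (x : g) : 'End(g) :=
  linfun (bracket x).

Definition endmx (K : fieldType) (V : vectType K) (f : 'End(V)) :=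
  passmx.mxof (vbasis {:V}) (vbasis {:V}) f.

Definition killing (K : fieldType) (g : lieAlgType K) (x y : g) : K :=
  \tr (endmx (ad x \o ad y)%VF).

(* Cartan subalgebras of a complex semisimple Lie algebra: abelian,
   ad-diagonalizable, and equal to their own centralizer. *)
Definition cartan_subalgebra (K : fieldType) (g : lieAlgType K)
    (t : {vspace g}) :=
  [/\ forall x y, x \in t -> y \in t -> bracket x y = 0,
      forall x, (forall h, h \in t -> bracket h x = 0) -> x \in t
    & forall h, h \in t -> diagonalizable (endmx (ad h))].

Section Roots.
Variables (K : fieldType) (g : lieAlgType K) (t : {vspace g}).
Local Notation "t^*" := 'Hom(subvs_of t, K^o).

Definition root_system : set t^* :=
  [set a | a != 0 /\
     exists2 x : g, x != 0 & forall h : subvs_of t,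
       bracket (vsval h) x = (a h : K) *: x].

(* The map t -> t^* given by the Killing form, and its inverse
   identifying t^* with t (a true inverse when the Killing form is
   nondegenerate on t). *)
Definition killing_dual : 'Hom(subvs_of t, t^*) :=
  linfun (fun h : subvs_of t =>
    @linfun K (subvs_of t) K^o (fun h' => killing (vsval h) (vsval h'))).

Definition of_dual (l : t^*) : subvs_of t := (killing_dual^-1)%VF l.

Definition cform (l m : t^*) : K :=
  killing (vsval (of_dual l)) (vsval (of_dual m)).

Definition coroot (c : t^*) : t^* := (2 / cform c c) *: c.

Definition positive_system (P : set t^*) :=
  [/\ P `<=` root_system,
      forall a, root_system a -> P a \/ P (- a),
      forall a, ~ (P a /\ P (- a))
    & forall a b, P a -> P b -> root_system (a + b) -> P (a + b)].

Definition simple_root (P : set t^*) : set t^* :=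
  [set a | P a /\ ~ exists b c, [/\ P b, P c & a = b + c]].

Definition orthogonal_sets (A B : set t^*) :=
  forall a b, A a -> B b -> cform a b = 0.

Definition irreducible_system (F : set t^*) :=
  F !=set0 /\
  forall A B, F = A `|` B -> orthogonal_sets A B -> A = set0 \/ B = set0.

Definition irreducible_component (F F1 : set t^*) :=
  [/\ F1 `<=` F, irreducible_system F1 & orthogonal_sets F1 (F `\` F1)].

(* F is a root subsystem with positive roots P `&` F, and every c in F
   satisfies c <= b in the resulting root order. *)
Definition highest_root (P F : set t^*) (b : t^*) :=
  F b /\
  forall c, F c ->
    exists2 s : seq t^*, forall d, d \in s -> (P `&` F) d
                       & b - c = \sum_(d <- s) d.

Inductive kostant_cascade (P : set t^*) : set t^* -> t^* -> Prop :=
| cascade_highest F b : highest_root P F b -> kostant_cascade P F b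
| cascade_rec F b F1 c :
    highest_root P F b ->
    irreducible_component [set a | F a /\ cform a b = 0] F1 ->
    kostant_cascade P F1 c -> kostant_cascade P F c.

Definition fundamental_weight (P : set t^*) (l : t^*) :=
  exists2 a, simple_root P a &
    forall b, simple_root P b -> cform l (coroot b) = (b == a)%:R.

(* The sum lives in t^* and is then transported to t; it ranges over a subset
   of the finite set root_system, so the convention for infinite supports in
   \sum_(_ \in _) is not triggered. *)
Definition cascade_element (P : set t^*) : subvs_of t :=
  of_dual (\sum_(b \in kostant_cascade P root_system) (cform b b)^-1 *: b).

End Roots.

Arguments root_system {K g} t.

Definition dominant (K : numFieldType) (g : lieAlgType K) (t : {vspace g})
    (P : set 'Hom(subvs_of t, K^o)) (x : subvs_of t) :=
  forall c, P c -> 0 <= (c x : K).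

(* Main.v *)
From HB Require Import structures.
Require Import Defs.
From mathcomp Require Import all_boot all_order all_algebra.
From mathcomp Require Import all_classical all_reals complex.
From mathcomp Require Import ring zify.

Set Implicit Arguments.
Unset Strict Implicit.
Unset Printing Implicit Defensive.
Import Order.TTheory GRing.Theory Num.Theory passmx.
Local Open Scope ring_scope.
Local Open Scope classical_set_scope.

(** The crux is the identity 2 alpha = sum of <alpha, c^vee> c over the cascade
    roots c, where alpha is the simple root not orthogonal to theta.

    Let w be the product of the pairwise commuting reflections in the cascade
    roots.  It turns every positive root x into a negative one
    ([cascade_reflection_neg]): follow the recursion that defines the cascade
    down to the first component F containing x whose highest root b is not
    orthogonal to x.  Then (x, b) > 0, and w x stays in F and has
    (w x, b) = - (x, b) < 0, which is impossible for a positive root of F.  So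
    -w is an additive involution that permutes the positive roots, hence the
    simple ones.  It fixes theta, and theta, being a fundamental weight, is
    non-orthogonal to only one simple root; hence w alpha = - alpha
    ([cascade_reflection_alpha]), which is the identity above.

    It remains to find the coefficients n_c = <alpha, c^vee>.  For c = theta
    both n_c and <theta, alpha^vee> are 1; for any other c not orthogonal to
    alpha, <c, alpha^vee> = -1, because the reflection of c in alpha is a root
    whose Cartan number with respect to theta is - <c, alpha^vee>, and theta is
    the only root on which that number exceeds 1.  Applying <., alpha^vee> to
    the identity gives 4 = 1 - S, where S is the sum of the n_c with
    c <> theta.  Thus S = -3 and alpha(x_K) = (1 + S) / 2 = -1, whereas
    theta(x_K) = 1 since the cascade roots are orthogonal to each other.

    The properties of roots that this uses ([crystallographic]) are derived
    from the Lie algebra.  As t acts diagonalizably, the algebra has a basis of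
    weight vectors.  For x and y in opposite root spaces, with h = [x, y], the
    usual sl2 computation, made on a primitive vector of a string of weights,
    shows that every weight takes on h a rational multiple of the value of the
    root ([weight_string]).  If the Killing form vanished identically, this
    would force [x, y] = 0 for all such x and y; the sum of the root spaces
    would then be an ideal, contradicting simplicity.  So the Killing form is
    nondegenerate, each root has an sl2 triple, and the same computation yields
    the integrality of Cartan numbers, unbroken root strings, and the
    positivity of (a, a), which is the inverse of a sum of rational squares.

    All of this works over any field of characteristic 0 with a compatible
    (partial) order, that is, over a [numFieldType]. *)

(** * The root system axioms *)

(** What the combinatorial part of the argument needs to know about the roots.  In
    [root_string] the string starts at b and goes down by multiples of a; the
    alternative to a root is the zero weight. *)
Record crystallographic (K : numFieldType) (g : lieAlgType K)
    (t : {vspace g}) : Prop := Crystallographic {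
  roots_finite : finite_set (root_system t);
  cform_sym : forall x y : 'Hom(subvs_of t, K^o), cform x y = cform y x;
  cform_linearl : forall (c : K) (x y z : 'Hom(subvs_of t, K^o)),
    cform (c *: x + y) z = c * cform x z + cform y z;
  root_norm_gt0 : forall a, root_system t a -> 0 < cform a a;
  root_opp : forall a, root_system t a -> root_system t (- a);
  root_string : forall a b, root_system t a -> root_system t b ->
    exists2 n : int, 2 * cform b a / cform a a = n%:~R &
      forall j : nat, (j%:Z <= n) ->
        root_system t (b - a *+ j) \/ b = a *+ j
}.

(** * Lie brackets and the Killing form *)

Section Bracket.
Context (K : fieldType) (g : lieAlgType K).
Implicit Types (x y z : g).

Lemma bracketr_is_linear x : linear (bracket x).
Proof. by move=> k y z; exact: bracket_linearr. Qed.
HB.instance Definition _ x := GRing.isSemilinear.Build K g g _ (bracket x)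
  (GRing.semilinear_linear (bracketr_is_linear x)).

(** The bracket with its arguments exchanged, so that linearity in the left
    argument can be registered as a canonical instance. *)
Definition bracketl x y : g := bracket y x.

Lemma bracketl_is_linear x : linear (bracketl x).
Proof. by move=> k y z; exact: bracket_linearl. Qed.
HB.instance Definition _ x := GRing.isSemilinear.Build K g g _ (bracketl x)
  (GRing.semilinear_linear (bracketl_is_linear x)).

Lemma bracketDl x y z : bracket (x + y) z = bracket x z + bracket y z.
Proof. exact: (linearD (bracketl z)). Qed.

Lemma bracketZl (k : K) x z : bracket (k *: x) z = k *: bracket x z.
Proof. exact: (linearZ_LR (bracketl z)). Qed.

Lemma bracket0l z : bracket 0 z = 0.
Proof. exact: (linear0 (bracketl z)). Qed.

Lemma bracket_suml (I : Type) (r : seq I) (F : I -> g) z :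
  bracket (\sum_(i <- r) F i) z = \sum_(i <- r) bracket (F i) z.
Proof. exact: (linear_sum (bracketl z)). Qed.

Lemma bracketC x y : bracket x y = - bracket y x.
Proof.
apply/eqP; rewrite -addr_eq0; have /eqP := bracket_alt (x + y).
by rewrite bracketDl !linearD /= !bracket_alt add0r addr0.
Qed.

Lemma bracket_derivation x y z :
  bracket x (bracket y z) = bracket (bracket x y) z + bracket y (bracket x z).
Proof.
have /eqP := bracket_jacobi x y z.
rewrite -addrA addr_eq0 => /eqP->; rewrite (bracketC z x) linearN /=.
by rewrite (bracketC z) opprD !opprK addrC.
Qed.

Lemma adE x y : ad x y = bracket x y.
Proof. by rewrite /ad lfunE. Qed.

Lemma ad_is_linear : linear (@ad K g).
Proof.
by move=> k x y; apply/lfunP => z; rewrite adE bracket_linearl add_lfunE scale_lfunE !adE.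
Qed.
HB.instance Definition _ := GRing.isSemilinear.Build K g 'End(g) _ (@ad K g)
  (GRing.semilinear_linear ad_is_linear).

Lemma ad_bracket x y : ad (bracket x y) = ((ad x \o ad y)%VF - (ad y \o ad x)%VF).
Proof.
apply/lfunP => z; rewrite adE add_lfunE opp_lfunE !comp_lfunE !adE.
by rewrite bracket_derivation addrK.
Qed.

(** Matrices act on row vectors, whence the reversed order. *)
Lemma endmx_comp (f f' : 'End(g)) : endmx (f \o f')%VF = endmx f' *m endmx f.
Proof. by apply: mxof_comp; exact: vbasisP. Qed.

Lemma killingC x y : killing x y = killing y x.
Proof. by rewrite /killing !endmx_comp mxtrace_mulC. Qed.

Lemma endmx_is_linear : linear (@endmx K g).
Proof. by move=> k x y; exact: linearP. Qed.
HB.instance Definition _ := GRing.isSemilinear.Build K 'End(g) _ _ (@endmx K g)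
  (GRing.semilinear_linear endmx_is_linear).

Lemma killing_is_linear x : linear (killing x : g -> K^o).
Proof.
move=> k y z; rewrite /killing linearP !endmx_comp linearP.
by rewrite mulmxDl -scalemxAl mxtraceD mxtraceZ.
Qed.
HB.instance Definition _ x := GRing.isSemilinear.Build K g K^o _ (killing x : g -> K^o)
  (GRing.semilinear_linear (killing_is_linear x)).

Lemma killing_invariant x y z : killing (bracket x y) z = killing x (bracket y z).
Proof.
rewrite /killing !endmx_comp !ad_bracket ![endmx (_ - _)]linearB /= !endmx_comp.
rewrite mulmxBr mulmxBl !linearB /= !mulmxA; congr (_ - _).
by rewrite mxtrace_mulC mulmxA.
Qed.

(** The Killing form is defined by the trace in one fixed basis, while it is to be
    computed in a basis of weight vectors. *)
Lemma trace_basis (e : (\dim {:g}).-tuple g) (f : 'End(g)) : basis_of {:g} e ->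
  \tr (endmx f) = \sum_i coord e i (f e`_i).
Proof.
move=> eB; have bB := vbasisP {:g}; set b := vbasis _ in bB.
have -> : endmx f = mxof b e \1%VF *m (mxof e e f *m mxof e b \1%VF).
  by rewrite -!mxof_comp // comp_lfun1l comp_lfun1r.
rewrite mxtrace_mulC -mulmxA -mxof_comp // comp_lfun1l.
rewrite mxof1 ?(basis_free eB) // mulmx1.
by apply: eq_bigr => i _; rewrite !mxE /= vecof_delta.
Qed.

End Bracket.

(** * Weight vectors *)

Section WeightBasis.
Context (K : fieldType) (g : lieAlgType K) (t : {vspace g}).
Local Notation V := 'Hom(subvs_of t, K^o).

Definition weight_vector (a : V) (x : g) : Prop :=
  forall h : subvs_of t, bracket (vsval h) x = (a h : K) *: x.

Definition weight_basis (e : (\dim {:g}).-tuple g) (lam : 'I_(\dim {:g}) -> V) :=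
  basis_of {:g} e /\ forall i, weight_vector (lam i) e`_i.

(** The operators ad h, for h in a basis of t, commute and are diagonalizable, so
    they are diagonalizable simultaneously; their common eigenvectors are
    eigenvectors of ad h for all h in t by linearity. *)
Lemma weight_basis_exists : cartan_subalgebra t -> exists e lam, weight_basis e lam.
Proof.
move=> [ab _ diag]; set b := vbasis {:g}; have bB : basis_of {:g} b := vbasisP _.
pose As := [seq endmx (ad x) | x <- vbasis t].
have [p pU /allP pD] : codiagonalizable As.
  apply/codiagonalizableP; split=> [_ _ /mapP[x xt ->] /mapP[y yt ->]|_ /mapP[x xt ->]].
    rewrite /comm_mx -!endmx_comp; congr endmx; apply/lfunP => z.
    rewrite !comp_lfunE !adE [LHS]bracket_derivation [bracket y x]ab ?bracket0l ?add0r //.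
      exact: (vbasis_mem yt).
    exact: (vbasis_mem xt).
  by apply: diag; exact: vbasis_mem xt.
pose e := [tuple vecof b (row i p) | i < \dim {:g}].
have eE (i : 'I_(\dim {:g})) : e`_i = vecof b (row i p).
  by rewrite -tnth_nth tnth_mktuple.
have eB : basis_of {:g} e.
  rewrite basisEdim size_tuple leqnn andbT; apply/subvP => x _.
  rewrite -[x](rVofK bB) -[rVof b x](mulmxKV pU) mulmx_sum_row linear_sum.
  apply: memv_suml => i _; rewrite linearZ /= memvZ // -eE memv_span //.
  by rewrite mem_nth // size_tuple.
have eE1 (i : 'I_(\dim {:g})) : coord e i e`_i = 1 by rewrite coord_free ?eqxx ?(basis_free eB).
have eig (i : 'I_(\dim {:g})) h : h \in t -> exists k : K, bracket h e`_i = k *: e`_i.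
  move=> ht; rewrite (coord_vbasis ht) bracket_suml.
  apply: (big_ind (fun x : g => exists k : K, x = k *: e`_i)) => [|x y|j _].
  - by exists 0; rewrite scale0r.
  - by move=> [k ->] [l ->]; exists (k + l); rewrite scalerDl.
  set x := _`_j; have xb : x \in vbasis t by rewrite mem_nth ?size_tuple.
  have /similar_diagPex[d /(similarP pU) dE] := pD _ (map_f _ xb).
  exists (coord (vbasis t) j h * d 0 i).
  rewrite bracketZl -scalerA -adE eE (hom_vecof b bB) -[mxof b b _]/(endmx _) -row_mul dE.
  by rewrite row_mul row_diag_mx -scalemxAl -rowE linearZ.
(* the eigenvalue is read off as a coordinate, which makes it linear in h *)
pose lam i : V := linfun (fun h : subvs_of t => coord e i (bracket (vsval h) e`_i) : K^o).
exists e, lam; split=> // i h.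
have [k kE] := eig i _ (subvsP h).
have lin : linear (fun h : subvs_of t => coord e i (bracket (vsval h) e`_i) : K^o).
  by move=> l x y; rewrite linearP bracket_linearl linearP.
pose f : {linear subvs_of t -> K^o} :=
  HB.pack (fun h : subvs_of t => coord e i (bracket (vsval h) e`_i) : K^o)
    (GRing.isLinear.Build _ _ _ _ _ lin).
rewrite /lam (lfunE f) /= kE linearZ /= eE1; congr (_ *: _).
exact: esym (mulr1 k).
Qed.

End WeightBasis.

Section Weights.
Context (K : numFieldType) (g : lieAlgType K) (t : {vspace g}).
Local Notation V := 'Hom(subvs_of t, K^o).
Local Notation n := (\dim {:g}).
Variables (e : n.-tuple g) (lam : 'I_n -> V).
Hypothesis cartan : cartan_subalgebra t.
Hypothesis wB : weight_basis e lam.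
Implicit Types (a b : V) (x y z : g) (h : subvs_of t).

Let eB : basis_of {:g} e. Proof. by case: wB. Qed.
Let eW i : weight_vector (lam i) e`_i. Proof. by case: wB => _; apply. Qed.

Lemma lfunMn a k h : (a *+ k) h = k%:R * (a h : K).
Proof. by rewrite -scaler_nat scale_lfunE. Qed.

Lemma coord_ee (i j : 'I_n) : coord e i e`_j = (i == j)%:R.
Proof. by rewrite coord_free ?(basis_free eB) // eq_sym. Qed.

Lemma basis_neq0 (i : 'I_n) : e`_i != 0.
Proof.
apply/eqP => e0; have := coord_ee i i; rewrite e0 linear0 eqxx => /eqP.
by rewrite eq_sym oner_eq0.
Qed.

Lemma sum_coord x : x = \sum_i coord e i x *: e`_i.
Proof. exact: (coord_basis eB (memvf x)). Qed.

(** Two weight vectors of different weights are independent, so the basis vectors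
    that occur in a weight vector share its weight. *)
Lemma weight_coord a x i : weight_vector a x -> coord e i x != 0 -> lam i = a.
Proof.
move=> ax xi; apply/lfunP => h.
have := congr1 (coord e i) (ax h).
rewrite {1}[x]sum_coord !linear_sum /= (bigD1 i) //= big1 => [|j ji].
  by rewrite !linearZ /= eW linearZ /= coord_ee eqxx addr0 mulr1 mulrC => /(mulIf xi).
by rewrite !linearZ /= eW linearZ /= coord_ee eq_sym (negPf ji) !mulr0.
Qed.

Lemma weight_occurs a x : weight_vector a x -> x != 0 -> exists i, lam i = a.
Proof.
move=> ax /eqP x0; apply: contrapT => nex; apply: x0.
rewrite [x]sum_coord big1 // => i _.
case: (eqVneq (coord e i x) 0) => [->|xi]; first by rewrite scale0r.
by case: nex; exists i; apply: weight_coord ax xi.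
Qed.

Lemma weight_bracket a b x y : weight_vector a x -> weight_vector b y ->
  weight_vector (a + b) (bracket x y).
Proof.
move=> ax bY h; rewrite bracket_derivation ax bY bracketZl linearZ /= -scalerDl.
by rewrite add_lfunE.
Qed.

Lemma weightZ a k x : weight_vector a x -> weight_vector a (k *: x).
Proof. by move=> ax h; rewrite linearZ /= ax !scalerA mulrC. Qed.

(** A Cartan subalgebra is its own centralizer. *)
Lemma weight0_cartan x : weight_vector (0 : V) x <-> x \in t.
Proof.
have [ab cent _] := cartan; split=> [x0|xt h]; last first.
  by rewrite ab ?subvsP // zero_lfunE scale0r.
apply: cent => h ht; have := x0 (vsproj t h).
by rewrite vsprojK // zero_lfunE scale0r.
Qed.

Lemma killing_cartan h1 h2 :
  killing (vsval h1) (vsval h2) = \sum_i (lam i h1 : K) * (lam i h2 : K).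
Proof.
rewrite /killing (trace_basis _ eB); apply: eq_bigr => i _.
by rewrite comp_lfunE !adE eW linearZ /= eW !linearZ /= coord_ee eqxx mulr1 mulrC.
Qed.

(** Invariance of the Killing form under ad h gives (a + b)(h) killing x y = 0. *)
Lemma killing_weight a b x y : weight_vector a x -> weight_vector b y ->
  killing x y != 0 -> b = - a.
Proof.
move=> ax bY kxy; apply/eqP; rewrite -addr_eq0 addrC; apply/eqP/lfunP => h.
have := killing_invariant x (vsval h) y.
rewrite bracketC ax bY -scaleNr killingC !linearZ /= killingC => /(mulIf kxy) kE.
by rewrite add_lfunE zero_lfunE -kE; exact: subrr.
Qed.

Lemma weight_iter a b x v k : weight_vector a x -> weight_vector b v ->
  weight_vector (b + a *+ k) (iter k (bracket x) v).
Proof.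
move=> ax bv; elim: k => [|k IH]; first by rewrite addr0.
by rewrite mulrS addrCA; apply: weight_bracket.
Qed.

(** Otherwise all the weights b + k a would occur, but there are only finitely
    many weights. *)
Lemma weight_nilpotent a b x v : a != 0 -> weight_vector a x -> weight_vector b v ->
  exists k, iter k (bracket x) v == 0.
Proof.
move=> a0 ax bv; apply: contrapT => nz.
have occ k : exists i, lam i = b + a *+ k.
  apply: (weight_occurs (weight_iter k ax bv)).
  by apply/negP => z; apply: nz; exists k.
have [f fE] := choice occ.
have inj : injective (fun k : 'I_n.+1 => f k).
  move=> i j fij; apply/val_inj => /=.
  have : b + a *+ i = b + a *+ j by rewrite -!fE fij.
  move=> /addrI; rewrite -!scaler_nat => /eqP.
  rewrite -subr_eq0 -scalerBl scaler_eq0 (negPf a0) orbF subr_eq0 eqr_nat.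
  by move/eqP.
by have := leq_card _ inj; rewrite !card_ord ltnn.
Qed.

(** The sl2 argument, without any assumption on a(h0) where h0 = [x, y].  Raise v
    by ad x to a vector u killed by ad x, of weight b + q a; then lower u by
    ad y until it dies, after m + 1 steps.  The commutation relation in [step]
    at the last step reads 2 (b + q a)(h0) = m a(h0), and the m + 1 nonzero
    vectors obtained on the way realize the weights b + q a - i a. *)
Lemma weight_string a b x y v h0 : a != 0 ->
  weight_vector a x -> weight_vector (- a) y -> bracket x y = vsval h0 ->
  weight_vector b v -> v != 0 ->
  exists q m : nat, (b h0 : K) = (a h0 : K) * (m%:R / 2 - q%:R) /\
    forall i, (i <= m)%N ->
      exists2 z, z != 0 & weight_vector (b + a *+ q - a *+ i) z.
Proof.
move=> a0 ax ay xy bv v0.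
have Na0 : - a != 0 by rewrite oppr_eq0.
have exq := weight_nilpotent a0 ax bv.
case: (ex_minnP exq) => -[|q] /eqP qz qmin; first by rewrite (qz : v = 0) eqxx in v0.
pose u := iter q (bracket x) v.
have u0 : u != 0 by apply/negP => /qmin; rewrite ltnn.
have bu : weight_vector (b + a *+ q) u by apply: weight_iter.
case: (ex_minnP (weight_nilpotent Na0 ay bu)) => -[|m] /eqP mz mmin.
  by rewrite (mz : u = 0) eqxx in u0.
pose f i := iter i (bracket y) u.
have fW i : weight_vector (b + a *+ q - a *+ i) (f i).
  by rewrite -mulNrn; apply: weight_iter.
pose mu : K := (b + a *+ q) h0; pose c : K := a h0.
have muE : mu = b h0 + c * q%:R.
  by rewrite /mu add_lfunE lfunMn mulrC.
have step i : bracket x (f i.+1) = (i.+1%:R * (mu - i%:R * c / 2)) *: f i.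
  elim: i => [|i IH].
    rewrite /f /= bracket_derivation xy bu -/u [bracket x u]qz linear0 addr0.
    by rewrite -/mu !mul0r subr0 mul1r.
  rewrite [f i.+2]/(bracket y (f i.+1)) bracket_derivation xy fW IH linearZ /=.
  rewrite -[bracket y (f i)]/(f i.+1) -scalerDl; congr (_ *: _).
  rewrite add_lfunE opp_lfunE lfunMn -/mu -/c.
  rewrite -[i.+2%:R]natr1 -[i.+1%:R]natr1.
  rewrite [X in X + _](_ : _ = mu - (i%:R + 1) * c) //.
  by field.
have fm0 : f m != 0 by apply/negP => /mmin; rewrite ltnn.
have /eqP : bracket x (f m.+1) = 0 by rewrite [f _]mz linear0.
rewrite step scaler_eq0 (negPf fm0) orbF mulf_eq0 pnatr_eq0 /= subr_eq0 => /eqP mE.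
exists q, m; split.
  by apply: (addIr (c * q%:R)); rewrite -muE mE -/c; field.
move=> i im; exists (f i) => //; apply/negP => /mmin; by rewrite ltnNge im.
Qed.

(** * Nondegeneracy of the Killing form *)

Hypothesis simple : lie_simple g.

(** A central element spans an ideal, and this line cannot be the whole algebra
    since the bracket is not zero. *)
Lemma simple_center z : (forall x, bracket x z = 0) -> z = 0.
Proof.
move=> zc; have [[x [y xy]] ids] := simple.
have [|z0|zT] := ids <[z]>%VS.
- by move=> u _ /vlineP[k ->]; rewrite linearZ /= zc scaler0 mem0v.
- by have := memv_line z; rewrite z0 memv0 => /eqP.
have /vlineP[k yE] : y \in <[z]>%VS by rewrite zT memvf.
by rewrite yE linearZ /= zc scaler0 eqxx in xy.
Qed.

Lemma weight_central h : (forall i, lam i h = 0) -> vsval h = 0.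
Proof.
move=> lh; apply: simple_center => x; rewrite bracketC [x]sum_coord linear_sum /=.
by rewrite big1 ?oppr0 // => i _; rewrite linearZ /= eW lh scale0r scaler0.
Qed.

Lemma string_weights a x y h0 : a != 0 ->
  weight_vector a x -> weight_vector (- a) y -> bracket x y = vsval h0 ->
  exists r : 'I_n -> rat, forall i, lam i h0 = (a h0 : K) * ratr (r i).
Proof.
move=> a0 ax ay xy.
suff rE i : exists r : rat, lam i h0 = (a h0 : K) * ratr r.
  by have [r ?] := choice rE; exists r.
have [q [m [-> _]]] := weight_string a0 ax ay xy (eW i) (basis_neq0 i).
by exists (m%:R / 2 - q%:R); rewrite rmorphB fmorph_div !rmorph_nat.
Qed.

(** The Killing norm of h0 is the sum of the squares of the weights at h0; these
    are rational multiples of a(h0), and the multiple belonging to the weight a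
    is 1. *)
Lemma string_norm a x y h0 : a != 0 -> x != 0 ->
  weight_vector a x -> weight_vector (- a) y -> bracket x y = vsval h0 ->
  exists2 r : K, 0 < r &
    killing (vsval h0) (vsval h0) = (a h0 : K) ^+ 2 * r.
Proof.
move=> a0 x0 ax ay xy; have [r rE] := string_weights a0 ax ay xy.
have [i0 i0E] := weight_occurs ax x0.
have kE : killing (vsval h0) (vsval h0) = (a h0 : K) ^+ 2 * \sum_i ratr (r i) ^+ 2.
  rewrite killing_cartan mulr_sumr; apply: eq_bigr => i _.
  by rewrite rE -expr2 exprMn.
case: (eqVneq (a h0 : K) 0) => [c0|c0].
  by exists 1; rewrite // kE c0 expr0n /= !mul0r.
exists (\sum_i ratr (r i) ^+ 2) => //.
have r1 : ratr (r i0) = 1 :> K.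
  by apply: (mulfI c0); rewrite -rE i0E mulr1.
rewrite (bigD1 i0) //= r1 expr1n; apply: ltr_wpDr => //.
by apply: sumr_ge0 => i _; rewrite -rmorphXn /= ler0q; exact: sqr_ge0.
Qed.

Lemma bracket_cartan a x y : weight_vector a x -> weight_vector (- a) y ->
  exists h0, bracket x y = vsval h0.
Proof.
move=> ax ay; exists (vsproj t (bracket x y)); rewrite vsprojK //.
by apply/weight0_cartan; rewrite -(subrr a); apply: weight_bracket.
Qed.

(** If a(h0) = 0, all weights vanish at h0, which makes h0 central. *)
Lemma string_nonisotropic a x y h0 : a != 0 -> weight_vector a x -> weight_vector (- a) y ->
  bracket x y = vsval h0 -> vsval h0 != 0 -> (a h0 : K) != 0.
Proof.
move=> a0 ax ay xy; apply: contraNneq => ah0.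
have [r rE] := string_weights a0 ax ay xy.
by apply/eqP/weight_central => i; rewrite rE ah0 mul0r.
Qed.

(** If the Killing form were zero, opposite root spaces would commute with each
    other by [string_norm].  Then the sum J of the root spaces is an ideal: a
    bracket of root vectors has a nonzero weight or vanishes.  But J is neither
    zero, as the algebra is not abelian, nor everything, as t would be zero and
    could not be its own centralizer. *)
Lemma killing_nonzero : exists x y : g, killing x y != 0.
Proof.
apply: contrapT => nex.
have k0 x y : killing x y = 0.
  by apply/eqP; apply: contrapT => /negP xy; apply: nex; exists x, y.
have opp0 a x y : a != 0 -> weight_vector a x -> weight_vector (- a) y ->
    bracket x y = 0.
  move=> a0 ax ay; case: (eqVneq x 0) => [->|x0]; first exact: bracket0l.
  have [h0 xy] := bracket_cartan ax ay; rewrite xy.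
  apply/eqP; apply: contrapT => /negP h00.
  have [r r0 /esym/eqP] := string_norm a0 x0 ax ay xy.
  rewrite k0 mulf_eq0 expf_eq0 /= (negPf (string_nonisotropic a0 ax ay xy h00)).
  by rewrite gt_eqF.
pose J : {vspace g} := (\sum_(i | lam i != 0%R) <[e`_i]>)%VS.
have JP x : (forall i, lam i = 0 -> coord e i x = 0) -> x \in J.
  move=> x0; rewrite [x]sum_coord; apply: memv_suml => i _.
  case: (eqVneq (lam i) 0) => [/x0->|li]; first by rewrite scale0r mem0v.
  by apply: memvZ; apply: (subvP (sumv_sup i li (subvv _))); exact: memv_line.
have Jcoord x i : x \in J -> lam i = 0 -> coord e i x = 0.
  move=> /memv_sumP[v vJ ->] li; rewrite linear_sum big1 // => j lj.
  have /vlineP[k ->] := vJ j lj; rewrite linearZ /= coord_ee.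
  by case: eqVneq => [ij|_]; rewrite ?mulr0 //; rewrite -ij li eqxx in lj.
have [[x0 [y0 xy0]] ids] := simple.
have [|J0|JT] := ids J.
- move=> x _ /memv_sumP[v vJ ->]; rewrite linear_sum; apply: memv_suml => i li.
  have /vlineP[k ->] := vJ i li; rewrite linearZ /=; apply: memvZ.
  rewrite [x]sum_coord bracket_suml; apply: memv_suml => j _.
  rewrite bracketZl; apply: memvZ; case: (eqVneq (lam i) (- lam j)) => [lij|lij].
    rewrite (opp0 (lam j)) ?mem0v //; last by rewrite -lij.
    by apply: contraNneq li => lj; rewrite lij lj oppr0.
  apply: JP => m lm; apply/eqP; apply: contraNT lij => cm.
  have := weight_coord (weight_bracket (eW j) (eW i)) cm.
  by rewrite lm addrC => /esym/eqP; rewrite addr_eq0.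
- have l0 i : lam i = 0.
    apply/eqP; apply: contraNT (basis_neq0 i) => li.
    by rewrite -memv0 -J0; apply: (subvP (sumv_sup i li (subvv _))); exact: memv_line.
  have all_t x : x \in t.
    rewrite [x]sum_coord; apply: memv_suml => i _; apply: memvZ.
    by apply/weight0_cartan; rewrite -(l0 i).
  by have [ab _ _] := cartan; rewrite ab ?eqxx in xy0.
have t0 x : x \in t -> x = 0.
  move=> xt; rewrite [x]sum_coord big1 // => i _.
  rewrite (_ : coord e i x = 0) ?scale0r //; apply/eqP.
  apply: contrapT => /negP xi.
  have li := weight_coord ((weight0_cartan x).2 xt) xi.
  have := Jcoord e`_i i; rewrite JT memvf coord_ee eqxx => /(_ isT li)/eqP.
  by rewrite oner_eq0.
have [_ cent _] := cartan.
by rewrite (t0 x0) ?bracket0l ?eqxx // in xy0; apply: cent => h /t0->; exact: bracket0l.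
Qed.

(** The radical of an invariant form is an ideal. *)
Lemma killing_nondegenerate x : (forall y, killing x y = 0) -> x = 0.
Proof.
(* the radical as a kernel: the coefficients of F x are the values of the form
   at x and the basis vectors *)
pose F x : g := \sum_(i < n) (killing x e`_i) *: e`_i.
have linF : linear F.
  move=> k y z; rewrite /F scaler_sumr -big_split /=; apply: eq_bigr => i _.
  by rewrite ![killing _ e`_i]killingC linearP scalerDl scalerA.
pose f : {linear g -> g} := HB.pack F (GRing.isLinear.Build _ _ _ _ _ linF).
have kerP z : reflect (forall y, killing z y = 0) (z \in lker (linfun f)).
  rewrite memv_ker lfunE /=; apply: (iffP eqP) => [Fz y|z0]; last first.
    by rewrite /F big1 // => i _; rewrite z0 scale0r.
  rewrite [y]sum_coord linear_sum big1 // => i _; rewrite linearZ /=.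
  have := congr1 (coord e i) Fz; rewrite linear_sum linear0 (bigD1 i) //= big1.
    by rewrite linearZ /= coord_ee eqxx addr0 mulr1 => ->; exact: mulr0.
  by move=> j ji; rewrite linearZ /= coord_ee eq_sym (negPf ji) mulr0.
have [_ ids] := simple => x0.
have [|k0|kT] := ids (lker (linfun f)).
- move=> u z /kerP z0; apply/kerP => y.
  by rewrite bracketC -linearN /= killing_invariant z0.
- by apply/eqP; rewrite -memv0 -k0; apply/kerP.
have [y [z /eqP[]]] := killing_nonzero.
by apply/kerP; rewrite kT memvf.
Qed.

(** * The root system of a simple Lie algebra *)

Lemma killing_dualE h h' : (killing_dual t h h' : K) = killing (vsval h) (vsval h').
Proof.
have lin1 (k : subvs_of t) : linear (fun h' : subvs_of t => killing (vsval k) (vsval h') : K^o).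
  by move=> l x y; rewrite !linearP.
pose f1 (k : subvs_of t) : {linear subvs_of t -> K^o} :=
  HB.pack (fun h' : subvs_of t => killing (vsval k) (vsval h') : K^o)
    (GRing.isLinear.Build _ _ _ _ _ (lin1 k)).
have lin2 : linear (fun k : subvs_of t => linfun (f1 k)).
  move=> l x y; apply/lfunP => z; rewrite add_lfunE scale_lfunE !lfunE /=.
  by rewrite ![killing _ (vsval z)]killingC !linearP.
pose f2 : {linear subvs_of t -> V} :=
  HB.pack (fun k : subvs_of t => linfun (f1 k)) (GRing.isLinear.Build _ _ _ _ _ lin2).
by rewrite /killing_dual (lfunE f2) /= (lfunE (f1 h)).
Qed.

(** t is orthogonal to all root spaces. *)
Lemma cartan_nondegenerate h :
  (forall h', killing (vsval h) (vsval h') = 0) -> h = 0.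
Proof.
move=> h0; apply/val_inj/killing_nondegenerate => y /=.
rewrite [y]sum_coord linear_sum big1 // => i _; rewrite linearZ /=.
suff -> : killing (vsval h) e`_i = 0 by exact: mulr0.
have W0 : weight_vector (0 : V) (vsval h) by apply/weight0_cartan; exact: subvsP.
apply/eqP; apply: contrapT => /negP hi.
have li : lam i = 0 by rewrite (killing_weight W0 (eW i) hi) oppr0.
have eit : e`_i \in t by apply/weight0_cartan; rewrite -li.
by case/negP: hi; have := h0 (vsproj t e`_i); rewrite vsprojK // => ->.
Qed.

Lemma killing_dual_inj : lker (killing_dual t) == 0%VS.
Proof.
apply/lker0P => h1 h2 e12; apply/eqP; rewrite -subr_eq0; apply/eqP.
apply: cartan_nondegenerate => h'; rewrite -killing_dualE linearB /=.
by rewrite e12 subrr zero_lfunE.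
Qed.

Lemma of_dualK a : killing_dual t (of_dual a) = a.
Proof.
apply: limg_lfunVK; suff -> : limg (killing_dual t) = fullv by exact: memvf.
apply/eqP; rewrite eqEdim subvf limg_dim_eq; last first.
  by rewrite (eqP killing_dual_inj) capv0.
by rewrite !dimvf /= /dim /= muln1.
Qed.

Lemma killing_of_dual a h : killing (vsval (of_dual a)) (vsval h) = a h.
Proof. by rewrite -killing_dualE of_dualK. Qed.

(** The form on the dual is evaluation at the element of t that represents the
    second argument. *)
Lemma cformE a b : cform a b = a (of_dual b).
Proof. by rewrite /cform killing_of_dual. Qed.

Lemma of_dual_neq0 a : a != 0 -> vsval (of_dual a) != 0.
Proof.
apply: contraNneq => a0; have e0 : of_dual a = 0 by apply/val_inj.
by rewrite -[a]of_dualK e0 linear0.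
Qed.

(** In the definition of a root, nonvanishing is that of the underlying function;
    here it is that of the linear form. *)
Lemma rootP a : root_system t a <-> a != 0 /\ exists2 x, x != 0 & weight_vector a x.
Proof.
split=> -[a0 ax]; split=> //; apply: contraNneq a0 => a0.
  by apply/eqP/funext => h; rewrite a0 zero_lfunE.
by apply/eqP/lfunP => h; rewrite a0 zero_lfunE.
Qed.

(** By nondegeneracy some basis vector y pairs with x; its weight must be -a, and
    scaling it gives killing x y = 1.  Then [x, y] represents a, by invariance. *)
Lemma root_sl2 a : root_system t a -> exists x y,
  [/\ x != 0, y != 0, weight_vector a x, weight_vector (- a) y &
      bracket x y = vsval (of_dual a)].
Proof.
move=> /rootP[a0 [x x0 ax]].
have [i xi] : exists i : 'I_n, killing x e`_i != 0.
  apply: contrapT => nex; case/eqP: x0; apply: killing_nondegenerate => y.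
  rewrite [y]sum_coord linear_sum big1 // => i _; rewrite linearZ /=.
  suff -> : killing x e`_i = 0 by exact: mulr0.
  by apply/eqP; apply: contrapT => /negP xi; apply: nex; exists i.
have li := killing_weight ax (eW i) xi.
pose k : K := killing x e`_i.
have ay : weight_vector (- a) (k^-1 *: e`_i) by apply: weightZ; rewrite -li.
have kxy : killing x (k^-1 *: e`_i) = 1 by rewrite linearZ /=; exact: mulVf.
exists x, (k^-1 *: e`_i); split=> //.
  by rewrite scaler_eq0 negb_or invr_eq0 xi basis_neq0.
have [h0 xy] := bracket_cartan ax ay; rewrite xy.
congr vsval; apply/eqP; rewrite -subr_eq0; apply/eqP/cartan_nondegenerate => h.
rewrite killingC linearB /= ![killing (vsval h) _]killingC killing_of_dual -xy.
rewrite killing_invariant bracketC ay opp_lfunE scaleNr opprK linearZ /= kxy.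
by rewrite [_ *: _]mulr1; exact: subrr.
Qed.

Lemma cform_root_neq0 a : root_system t a -> cform a a != 0.
Proof.
move=> Da; have [x [y [x0 _ ax ay xy]]] := root_sl2 Da.
have [a0 _] := (rootP a).1 Da; rewrite cformE.
exact: string_nonisotropic ax ay xy (of_dual_neq0 a0).
Qed.

Lemma root_system_crystallographic : crystallographic t.
Proof.
split.
- apply: (@sub_finite_set _ _ [set` [seq lam i | i <- enum 'I_n]]); last exact: finite_seq.
  move=> a /rootP[_ [x x0 ax]]; have [i <-] := weight_occurs ax x0.
  by apply/mapP; exists i; rewrite ?mem_enum.
- by move=> a b; rewrite /cform killingC.
- by move=> k a b c; rewrite !cformE add_lfunE scale_lfunE.
- move=> a Da; have [x [y [x0 _ ax ay xy]]] := root_sl2 Da.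
  have [a0 _] := (rootP a).1 Da.
  have [r r0 kE] := string_norm a0 x0 ax ay xy.
  have aa := cform_root_neq0 Da.
  (* (a, a) is both the Killing norm of the vector representing a and the value
     of a there, so that string_norm becomes (a, a) = (a, a)^2 r *)
  have : cform a a * r = 1.
    apply: (mulfI aa); rewrite mulr1 mulrA -expr2.
    by rewrite [in LHS]cformE -kE.
  by move=> ar; rewrite -(pmulr_lgt0 _ r0) ar ltr01.
- move=> a Da; have [x [y [_ y0 _ ay _]]] := root_sl2 Da.
  by apply/rootP; split; [rewrite oppr_eq0; case: ((rootP a).1 Da) | exists y].
move=> a b Da Db; have [x [y [x0 _ ax ay xy]]] := root_sl2 Da.
have [a0 _] := (rootP a).1 Da; have [b0 [v v0 bv]] := (rootP b).1 Db.
have [q [m [bE str]]] := weight_string a0 ax ay xy bv v0.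
have aa := cform_root_neq0 Da.
(* b (h) = n a (h) / 2 with n = m - 2 q, and b - j a is i = q + j steps below the
   top of the string, which has length m *)
exists (m%:Z - (q *+ 2)%:Z) => [|j jn].
  rewrite [cform b a]cformE bE -cformE rmorphB /= -!pmulrn mulr2n natrD.
  by field.
have [|z z0 zW] := str (q + j)%N.
  by move: jn; lia.
rewrite mulrnDr opprD addrA addrK in zW.
case: (eqVneq b (a *+ j)) => [->|baj]; first by right.
by left; apply/rootP; split; [rewrite subr_eq0 | exists z].
Qed.

End Weights.

(** * Cartan numbers and reflections *)

(** Sets of roots are predicates; inductions on their size use as measure the
    number of members in an enumeration of all the roots. *)
Lemma count_lt (T : eqType) (p q : pred T) (s : seq T) (x : T) :
  (forall y, p y -> q y) -> x \in s -> q x -> ~~ p x ->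
  (count p s < count q s)%N.
Proof.
move=> pq + qx px; elim: s => //= y s IH; rewrite inE => /predU1P[<-|/IH lt_s].
  by rewrite qx (negPf px) add0n add1n ltnS; apply: sub_count.
rewrite -addnS; apply: leq_add => //.
by case: (p y) (pq y) => // ->.
Qed.

Section RootSystem.
Context (K : numFieldType) (g : lieAlgType K) (t : {vspace g}).
Local Notation V := 'Hom(subvs_of t, K^o).
Local Notation Delta := (root_system t).
Implicit Types (x y z a b c d : V) (F P Q : set V) (s : seq V).

Hypothesis crys : crystallographic t.

Lemma cformDl x y z : cform (x + y) z = cform x z + cform y z.
Proof. by rewrite -[x]scale1r (cform_linearl crys) mul1r scale1r. Qed.

Lemma cform0l z : cform 0 z = 0.
Proof. by apply: (addIr (cform 0 z)); rewrite -cformDl !add0r. Qed.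

Lemma cformZl (k : K) x z : cform (k *: x) z = k * cform x z.
Proof. by rewrite -[k *: x]addr0 (cform_linearl crys) cform0l addr0. Qed.

Lemma cformNl x z : cform (- x) z = - cform x z.
Proof. by rewrite -scaleN1r cformZl mulN1r. Qed.

Lemma cformBl x y z : cform (x - y) z = cform x z - cform y z.
Proof. by rewrite cformDl cformNl. Qed.

Lemma cform_suml (I : Type) (s : seq I) (f : I -> V) z :
  cform (\sum_(i <- s) f i) z = \sum_(i <- s) cform (f i) z.
Proof.
elim: s => [|i s IH]; first by rewrite !big_nil cform0l.
by rewrite !big_cons cformDl IH.
Qed.

Lemma cformDr x y z : cform z (x + y) = cform z x + cform z y.
Proof. by rewrite !(cform_sym crys z) cformDl. Qed.

Lemma cformNr x z : cform z (- x) = - cform z x.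
Proof. by rewrite !(cform_sym crys z) cformNl. Qed.

Lemma cformZr (k : K) x z : cform z (k *: x) = k * cform z x.
Proof. by rewrite !(cform_sym crys z) cformZl. Qed.

Lemma root_neq0 a : Delta a -> a != 0.
Proof.
move=> /(root_norm_gt0 crys); apply: contraTneq => ->.
by rewrite cform0l ltxx.
Qed.

Definition cartan_number (b a : V) : K := 2 * cform b a / cform a a.
Local Notation cn := cartan_number.

Lemma cartan_numberD x y a : cn (x + y) a = cn x a + cn y a.
Proof. by rewrite /cn cformDl mulrDr mulrDl. Qed.

Lemma cartan_numberZ (k : K) x a : cn (k *: x) a = k * cn x a.
Proof. by rewrite /cn cformZl [2 * _]mulrCA !mulrA. Qed.

Lemma cartan_numberxx a : Delta a -> cn a a = 2.
Proof. by move=> /(root_norm_gt0 crys) a0; rewrite /cn mulfK ?gt_eqF. Qed.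

Lemma cartan_number_eq0 x a : Delta a -> (cn x a == 0) = (cform x a == 0).
Proof.
move=> /(root_norm_gt0 crys)/gt_eqF a0.
by rewrite /cn !mulf_eq0 invr_eq0 a0 pnatr_eq0 orbF.
Qed.

Lemma cartan_number_gt0 x a : Delta a -> (0 < cn x a) = (0 < cform x a).
Proof.
move=> /(root_norm_gt0 crys) a0.
by rewrite /cn pmulr_lgt0 ?invr_gt0 // pmulr_rgt0.
Qed.

Lemma cartan_number_int a b : Delta a -> Delta b -> exists n : int, cn b a = n%:~R.
Proof. by move=> Da Db; have [n ? _] := root_string crys Da Db; exists n. Qed.

(** The scalars are only partially ordered, so that comparing (a, b) with 0 needs
    this: (a, b) is rational, by integrality and (b, b) > 0. *)
Lemma cform_real a b : Delta a -> Delta b -> cform a b \is Num.real.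
Proof.
move=> Da Db; have [n e] := cartan_number_int Db Da.
have b0 := root_norm_gt0 crys Db.
have -> : cform a b = 2^-1 * (cn a b * cform b b).
  by rewrite /cn mulfVK ?gt_eqF // mulKf ?pnatr_eq0.
rewrite e; apply: realM; first by rewrite realV realn.
by apply: realM; [exact: realz | exact: gtr0_real].
Qed.

Lemma root_sub a b : Delta a -> Delta b -> 0 < cform b a ->
  Delta (b - a) \/ b = a.
Proof.
move=> Da Db; rewrite -(cartan_number_gt0 _ Da).
have [n e str] := root_string crys Da Db; rewrite /cn e ltr0z => n0.
by have := str 1%N n0; rewrite mulr1n.
Qed.

Lemma root_add a b : Delta a -> Delta b -> cform b a < 0 ->
  Delta (b + a) \/ b = - a.
Proof.
move=> Da Db ba0; rewrite -[in b + a](opprK a); apply: root_sub => //.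
  exact: root_opp.
by rewrite cformNr oppr_gt0.
Qed.

Lemma root_reflection a b : Delta a -> Delta b -> Delta (b - cn b a *: a).
Proof.
have pos a' b' : Delta a' -> Delta b' -> 0 <= cn b' a' ->
    Delta (b' - cn b' a' *: a').
  move=> Da Db; have [n e str] := root_string crys Da Db.
  rewrite /cn e ler0z; case: n e str => // n e str _.
  have [|//|eb] := str n; first by rewrite lexx.
    by rewrite -pmulrn scaler_nat.
  (* if the reflected vector b - n a were zero, the Cartan number n of b = n a
     would be 2 n *)
  move: e; rewrite -pmulrn -/(cn _ _) eb -scaler_nat cartan_numberZ.
  rewrite cartan_numberxx // => /eqP; rewrite -[X in _ == X]mulr1.
  rewrite -subr_eq0 -mulrBr mulf_eq0 => /orP[/eqP n0|].
    by case/root_neq0/negP: Db; rewrite eb -scaler_nat n0 scale0r.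
  by rewrite -[2]/(1 + 1) addrK oner_eq0.
move=> Da Db; have [n e] := cartan_number_int Da Db.
have [n0|/ltW n0] := lerP 0 n; first by apply: pos => //; rewrite e ler0z.
(* a and - a define the same reflection *)
have eN : cn b (- a) = - cn b a.
  by rewrite /cn cformNr cformNl cformNr opprK mulrN mulNr.
have := pos (- a) b (root_opp crys Da) Db.
by rewrite eN scalerN scaleNr opprK; apply; rewrite e oppr_ge0 lerz0.
Qed.

(** * Sums of positive roots *)

(** The root order, in the form in which highest roots are defined:
    x <= y when y - x is in the cone. *)
Definition cone (Q : set V) : set V :=
  [set x | exists2 s : seq V, forall d, d \in s -> Q d & x = \sum_(d <- s) d].

Lemma cone0 Q : cone Q 0.
Proof. by exists [::] => [d|]; rewrite ?big_nil. Qed.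

Lemma cone1 Q x : Q x -> cone Q x.
Proof. by move=> Qx; exists [:: x] => [d|]; rewrite ?big_seq1 // inE => /eqP->. Qed.

Lemma coneD Q x y : cone Q x -> cone Q y -> cone Q (x + y).
Proof.
move=> [s sQ ->] [u uQ ->]; exists (s ++ u); last by rewrite big_cat.
by move=> d; rewrite mem_cat => /orP[/sQ|/uQ].
Qed.

Lemma coneMn Q x n : cone Q x -> cone Q (x *+ n).
Proof.
by move=> Qx; elim: n => [|n IH]; rewrite ?mulr0n ?mulrS; [exact: cone0 | exact: coneD].
Qed.

Lemma cone_sub Q Q' x : Q `<=` Q' -> cone Q x -> cone Q' x.
Proof. by move=> QQ' [s sQ ->]; exists s => // d /sQ/QQ'. Qed.

Lemma cone_cform_ge0 Q x y : (forall d, Q d -> 0 <= cform y d) ->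
  cone Q x -> 0 <= cform y x.
Proof.
move=> ge0 [s sQ ->]; rewrite (cform_sym crys) cform_suml big_seq.
by apply: sumr_ge0 => d /sQ/ge0; rewrite (cform_sym crys).
Qed.

Section Positive.
Variable P : set V.
Hypothesis posP : positive_system P.

Lemma pos_root a : P a -> Delta a.
Proof. by case: posP => PD _ _ _; apply: PD. Qed.

Lemma root_pos a : Delta a -> P a \/ P (- a).
Proof. by case: posP => _ + _ _; apply. Qed.

Lemma pos_oppF a : P a -> P (- a) -> False.
Proof. by case: posP => _ _ PN _ Pa PNa; apply: (PN a). Qed.

Lemma posD a b : P a -> P b -> Delta (a + b) -> P (a + b).
Proof. by case: posP => _ _ _; apply. Qed.

(** A vanishing nonempty sum of positive roots can be shortened: a summand x has
    a negative product with the sum - x of the others, hence with one of them, y,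
    and x and y may be replaced by the positive root x + y.  This ends with a
    single root, which is not zero. *)
Lemma pos_sum_eq0 s : (forall d, d \in s -> P d) -> \sum_(d <- s) d = 0 -> s = [::].
Proof.
have [n] := ubnP (size s); elim: n s => // n IH [|x s] //=; rewrite ltnS => les Ps.
rewrite big_cons => sum0; exfalso.
have Px : P x by apply: Ps; rewrite mem_head.
have Ps' y : y \in s -> P y by move=> ys; apply: Ps; rewrite inE ys orbT.
have x0 := root_norm_gt0 crys (pos_root Px).
have sumE : \sum_(d <- s) d = - x by apply/eqP; rewrite -addr_eq0 addrC sum0.
have [y ys xy] : exists2 y, y \in s & cform y x < 0.
  apply/hasP; apply: contraTT x0 => /hasPn ge0; apply/negP => x0.
  have: 0 <= cform (\sum_(d <- s) d) x.
    rewrite cform_suml big_seq sumr_ge0 // => y ys.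
    rewrite real_leNgt ?real0 ?ge0 // cform_real //; apply: pos_root => //; exact: Ps'.
  by rewrite sumE cformNl oppr_ge0 => /(lt_le_trans x0); rewrite ltxx.
have Py := Ps' y ys.
case: (root_add (pos_root Px) (pos_root Py) xy) => [Dyx|yx]; last first.
  by apply: (@pos_oppF x) => //; rewrite -yx.
suff: (y + x) :: rem y s = [::] by [].
have s0 : (0 < size s)%N by case: (s) ys.
apply: IH; first by rewrite /= size_rem // prednK.
  move=> d; rewrite inE => /predU1P[->|/mem_rem]; [exact: posD | exact: Ps'].
by rewrite big_cons [y + x]addrC -addrA -[RHS]sum0 (perm_big _ (perm_to_rem ys)) big_cons.
Qed.

Lemma cone_antisym x : cone P x -> cone P (- x) -> x = 0.
Proof.
move=> [s sP es] [u uP eu].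
have : s ++ u = [::].
  apply: pos_sum_eq0 => [d|]; first by rewrite mem_cat => /orP[/sP|/uP].
  by rewrite big_cat /= -es -eu subrr.
by case: s es {sP} => // ->; rewrite big_nil.
Qed.

(** * Subsystems and their components *)

(** The property shared by all systems met in the construction of the cascade; it
    contains closure under negation, sums and reflections, and is inherited by
    orthogonal complements of roots and by components. *)
Definition subsystem (F : set V) : Prop := F `<=` Delta /\
  forall (k l : K) x y, F x -> F y -> Delta (k *: x + l *: y) -> F (k *: x + l *: y).

Lemma subsystemN F x : subsystem F -> F x -> F (- x).
Proof.
move=> [FD Fcl] Fx; have := Fcl (-1) 0 x x Fx Fx.
by rewrite scale0r addr0 scaleN1r; apply; apply/(root_opp crys)/FD.
Qed.

Lemma subsystemD F x y : subsystem F -> F x -> F y -> Delta (x + y) -> F (x + y).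
Proof.
by move=> [_ Fcl] Fx Fy; have := Fcl 1 1 x y Fx Fy; rewrite !scale1r.
Qed.

Lemma subsystem_reflection F x y : subsystem F -> F x -> F y ->
  F (y - cn y x *: x).
Proof.
move=> [FD Fcl] Fx Fy; have := Fcl 1 (- cn y x) y x Fy Fx.
rewrite scale1r scaleNr; apply.
by apply: root_reflection; exact: FD.
Qed.

Lemma cform_self_neq0 x : Delta x -> cform x x != 0.
Proof. by move=> /(root_norm_gt0 crys)/lt0r_neq0. Qed.

(** A combination of two roots of F1 outside F1 would be orthogonal to both of
    them, hence to itself. *)
Lemma subsystem_component F F1 : subsystem F -> irreducible_component F F1 ->
  subsystem F1.
Proof.
move=> [FD Fcl] [F1F _ F1o]; split=> [x /F1F/FD //|k l x y F1x F1y D].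
apply: contrapT => nF1.
have Fz := Fcl k l x y (F1F _ F1x) (F1F _ F1y) D.
have zo w : F1 w -> cform (k *: x + l *: y) w = 0.
  by move=> F1w; rewrite (cform_sym crys) F1o.
have /eqP[] := cform_self_neq0 D.
by rewrite cformDr !cformZr !zo // !mulr0 addr0.
Qed.

Lemma subsystem_perp F b : subsystem F ->
  subsystem [set a | F a /\ cform a b = 0].
Proof.
move=> [FD Fcl]; split=> [x [/FD] //|k l x y [Fx xb] [Fy yb] D].
by split; [exact: Fcl | rewrite cformDl !cformZl xb yb !mulr0 addr0].
Qed.

(** If two components meet, each of them splits orthogonally into the part inside
    the other and the rest, so that irreducibility makes them equal. *)
Lemma component_disjoint F F1 F2 :
  irreducible_component F F1 -> irreducible_component F F2 ->
  F1 = F2 \/ forall x y, F1 x -> F2 y -> cform x y = 0.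
Proof.
move=> [F1F [_ irr1] o1] [F2F [_ irr2] o2].
have sub G H : G `<=` F -> orthogonal_sets H (F `\` H) ->
  (forall A B, G = A `|` B -> orthogonal_sets A B -> A = set0 \/ B = set0) ->
  (exists2 x, G x & H x) -> G `<=` H.
  move=> GF oH irrG [x Gx Hx].
  case: (irrG (G `&` H) (G `\` H)).
  - by rewrite setDE -setIUr setUCr setIT.
  - by move=> a b [_ Ha] [Gb nHb]; apply: oH => //; split=> //; apply: GF.
  - by move=> G0; exfalso; rewrite -[False]/(set0 x) -G0.
  by move=> G0 z Gz; apply: contrapT => nHz; rewrite -[False]/(set0 z) -G0.
case: (pselect (exists2 x, F1 x & F2 x)) => [[x F1x F2x]|disj].
  by left; apply/seteqP; split; apply: sub => //; exists x.
right=> x y F1x F2y; apply: o1 => //; split; first exact: F2F.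
by move=> F1y; apply: disj; exists y.
Qed.

(** The connected component of x in the graph of non-orthogonality on F. *)
Inductive linked (F : set V) (x : V) : V -> Prop :=
| linked_refl : linked F x x
| linked_step y z : linked F x y -> F z -> cform y z != 0 -> linked F x z.

Lemma linked_sub F x y : F x -> linked F x y -> F y.
Proof. by move=> Fx; case. Qed.

Lemma component_exists F x : subsystem F -> F x ->
  exists2 F1, irreducible_component F F1 & F1 x.
Proof.
move=> sF Fx; exists (linked F x); last exact: linked_refl.
have lF y : linked F x y -> F y by apply: linked_sub.
split=> //; last first.
  move=> y z ly [Fz nlz]; apply/eqP; apply: contrapT => /negP yz.
  by apply: nlz; apply: linked_step yz.
split; first by exists x; exact: linked_refl.
have half A B : linked F x = A `|` B -> orthogonal_sets A B -> A x -> B = set0.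
  move=> lAB oAB Ax.
  have lA y : linked F x y -> A y.
    elim=> {y} // y z ly Ay Fz yz.
    have : (A `|` B) z by rewrite -lAB; apply: linked_step yz.
    by case=> // Bz; rewrite (oAB y z) ?eqxx in yz.
  apply/seteqP; split=> // y By.
  have ly : linked F x y by rewrite lAB; right.
  have := cform_self_neq0 (proj1 sF _ (lF _ ly)).
  by rewrite (oAB y y) ?eqxx //; apply: lA.
move=> A B lAB oAB.
have : (A `|` B) x by rewrite -lAB; apply: linked_refl.
case=> [Ax|Bx]; [right | left]; first exact: half Ax.
apply: half Bx; first by rewrite lAB setUC.
by move=> a b Ba Ab; rewrite (cform_sym crys) oAB.
Qed.

(** The roots A reached from x in two steps of the non-orthogonality graph are
    already everything: if a is reached through d, b is a neighbour of a but not
    of d, and a is not a neighbour of x, then one of d + a and d - a is a root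
    and leads from x to b.  So A is orthogonal to its complement. *)
Lemma irreducible_link F x y : subsystem F -> irreducible_system F -> F x -> F y ->
  exists2 d, F d & cform x d != 0 /\ cform d y != 0.
Proof.
move=> sF [_ irr] Fx Fy.
pose A := [set z | F z /\ exists2 d, F d & cform x d != 0 /\ cform d z != 0].
have Ax : A x.
  by split=> //; exists x => //; split; apply: cform_self_neq0; apply: (proj1 sF).
have [|a b [Fa [d Fd [xd da]]] [Fb nAb]||F0] := irr A (F `\` A).
- by rewrite setDE setUIr setUCr setIT; apply/seteqP; split=> z; [right | case=> // -[]].
- apply/eqP; apply: contrapT => /negP ab; apply: nAb; split=> //.
  case: (eqVneq (cform d b) 0) => [db|db]; last by exists d.
  case: (eqVneq (cform x a) 0) => [xa|xa]; last by exists a.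
  have Dd := proj1 sF _ Fd; have Da := proj1 sF _ Fa.
  have [da0|da0] : cform d a < 0 \/ 0 < cform d a.
    by apply/orP; rewrite -real_neqr_lt ?real0 ?cform_real.
  - have [Dda|eda] := root_add Da Dd da0; last first.
      by rewrite eda cformNr xa oppr0 eqxx in xd.
    exists (d + a); first exact: subsystemD.
    by rewrite cformDr cformDl xa db addr0 add0r.
  have [Dda|eda] := root_sub Da Dd da0; last by rewrite eda xa eqxx in xd.
  exists (d - a); first by apply: subsystemD => //; exact: subsystemN.
  by rewrite cformDr cformDl cformNr cformNl xa db oppr0 addr0 add0r oppr_eq0.
- by move=> A0; exfalso; rewrite -[False]/(set0 x) -A0.
have : A y by apply: contrapT => nAy; rewrite -[False]/(set0 y) -F0.
by case.
Qed.

(** * Highest roots *)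

Definition maximal_root F m :=
  F m /\ forall d, F d -> cone (P `&` F) (d - m) -> d = m.

Lemma cone_posI F x : cone (P `&` F) x -> cone P x.
Proof. by apply: cone_sub => z []. Qed.

(** The root order on a finite system is antisymmetric, so going up from c stops:
    the number of roots above decreases. *)
Lemma maximal_above F c : subsystem F -> F c ->
  exists2 m, maximal_root F m & cone (P `&` F) (m - c).
Proof.
move=> [FD _]; have [s sE] := (finite_seqP _).1 (roots_finite crys).
pose up c d := `[< F d /\ cone (P `&` F) (d - c) >].
have [n] := ubnP (count (up c) s); elim: n c => // n IH c; rewrite ltnS => lec Fc.
case: (pselect (maximal_root F c)) => [mc|nmc].
  by exists c => //; rewrite subrr; exact: cone0.
have [d Fd [cd dc]] : exists2 d, F d & cone (P `&` F) (d - c) /\ d != c.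
  apply: contrapT => nd; apply: nmc; split=> // d Fd cd; apply/eqP.
  by apply: contrapT => /negP dc; apply: nd; exists d.
have [|//|m mm md] := IH d; last first.
  by exists m => //; have := coneD md cd; rewrite addrA subrK.
apply: leq_trans lec; apply: (count_lt (x := c)).
- move=> y /asboolP[Fy yd]; apply/asboolP; split=> //.
  by have := coneD yd cd; rewrite addrA subrK.
- by have := FD _ Fc; rewrite sE.
- by apply/asboolP; split=> //; rewrite subrr; exact: cone0.
apply/asboolP => -[_ cdN]; case/negP: dc; rewrite -subr_eq0; apply/eqP.
by apply: cone_antisym; [exact: cone_posI cd | rewrite opprB; exact: cone_posI cdN].
Qed.

Lemma maximal_dominant F m d : subsystem F -> maximal_root F m ->
  P d -> F d -> 0 <= cform m d.
Proof.
move=> sF [Fm maxm] Pd Fd; have [FD _] := sF.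
have Dm := FD _ Fm; have Dd := FD _ Fd.
rewrite real_leNgt ?real0 ?cform_real //; apply/negP => md.
have [Dmd|emd] := root_add Dd Dm md.
  case/negP: (root_neq0 Dd); rewrite -(inj_eq (addrI m)) addr0; apply/eqP.
  apply: maxm; first exact: subsystemD.
  by rewrite addrAC subrr add0r; apply: cone1.
have edm : d = m.
  by apply: maxm => //; rewrite emd opprK; apply: coneD; apply: cone1.
by apply: (pos_oppF Pd); rewrite -emd -edm.
Qed.

(** Let d be positive and non-orthogonal to both m and m'; by dominance both
    products are positive.  Then m - d is zero or a positive root, by maximality
    of m, so (m', m) = (m', d) + (m', m - d) > 0 and m' - m is a root or zero.  A
    root would contradict the maximality of m or of m'. *)
Lemma maximal_uniq F m m' : subsystem F -> irreducible_system F ->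
  maximal_root F m -> maximal_root F m' -> m = m'.
Proof.
move=> sF irr mm mm'; have [Fm maxm] := mm; have [Fm' maxm'] := mm'.
have [FD _] := sF.
have [d Fd [md dm']] := irreducible_link sF irr Fm Fm'.
wlog Pd : d Fd md dm' / P d.
  move=> W; case: (root_pos (FD _ Fd)) => Pd; first exact: (W d).
  apply: (W (- d)) => //; first exact: subsystemN.
    by rewrite cformNr oppr_eq0.
  by rewrite cformNl oppr_eq0.
have md0 : 0 < cform m d by rewrite lt0r md (maximal_dominant sF).
have m'd0 : 0 < cform m' d.
  by rewrite lt0r (cform_sym crys m') dm' (cform_sym crys) (maximal_dominant sF).
have mdC : cone (P `&` F) (m - d).
  case: (root_sub (FD _ Fd) (FD _ Fm) md0) => [Dmd|->]; last first.
    by rewrite subrr; apply: cone0.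
  have Fmd : F (m - d) by apply: subsystemD => //; exact: subsystemN.
  case: (root_pos Dmd) => Pmd; first exact: cone1.
  rewrite opprB in Pmd.
  rewrite (maxm d) ?subrr //; first exact: cone0.
  by apply: cone1; split=> //; rewrite -opprB; exact: subsystemN.
have m'm : 0 < cform m' m.
  rewrite -(subrK d m) cformDr; apply: ltr_wpDl => //.
  apply: cone_cform_ge0 mdC => z [Pz Fz]; exact: maximal_dominant mm' _ _.
case: (root_sub (FD _ Fm) (FD _ Fm') m'm) => [Dmm|//].
have Fmm : F (m' - m) by apply: subsystemD => //; exact: subsystemN.
case: (root_pos Dmm) => Pmm; first by rewrite (maxm m') //; exact: cone1.
apply: maxm' => //; rewrite -opprB; apply: cone1; split=> //; exact: subsystemN.
Qed.

(** Every root lies below a maximal one, and there is only one of these. *)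
Lemma highest_root_exists F : subsystem F -> irreducible_system F ->
  exists b, highest_root P F b.
Proof.
move=> sF irr; have [[c0 Fc0] _] := irr.
have [b mb _] := maximal_above sF Fc0.
exists b; split=> [|c Fc]; first by case: mb.
by have [b' mb' b'c] := maximal_above sF Fc; rewrite (maximal_uniq sF irr mb mb').
Qed.

Lemma highest_root_maximal F b : highest_root P F b -> maximal_root F b.
Proof.
move=> [Fb hib]; split=> // d Fd db; apply/eqP; rewrite -subr_eq0; apply/eqP.
apply: cone_antisym; first exact: cone_posI db.
by rewrite opprB; apply: (@cone_posI F); apply: hib.
Qed.

Lemma highest_root_uniq F b b' : highest_root P F b -> highest_root P F b' -> b = b'.
Proof.
move=> hb hb'; have [Fb' maxb'] := highest_root_maximal hb'.
by apply: maxb'; [case: hb | case: hb => _; apply].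
Qed.

Lemma highest_root_dominant F b d : subsystem F -> highest_root P F b ->
  P d -> F d -> 0 <= cform b d.
Proof. by move=> sF /highest_root_maximal; exact: maximal_dominant. Qed.

Lemma highest_root_pos F b : subsystem F -> highest_root P F b -> P b.
Proof.
move=> sF hb; have [Fb _] := hb; have Db := proj1 sF _ Fb.
case: (root_pos Db) => // PNb.
have := highest_root_dominant sF hb PNb (subsystemN sF Fb).
by rewrite cformNr oppr_ge0 => /(lt_le_trans (root_norm_gt0 crys Db)); rewrite ltxx.
Qed.

(** * The cascade *)

Lemma subsystem_root : subsystem Delta.
Proof. by split. Qed.

(** The systems visited by the recursion that defines the cascade; their highest
    roots are the cascade roots. *)
Inductive cascade_node : set V -> Prop :=
| node_top : cascade_node Delta
| node_sub F b F1 : cascade_node F -> highest_root P F b ->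
    irreducible_component [set a | F a /\ cform a b = 0] F1 -> cascade_node F1.

Lemma node_subsystem F : cascade_node F -> subsystem F.
Proof.
elim=> [|{}F b F1 _ sF _ iF1]; first exact: subsystem_root.
exact: subsystem_component (subsystem_perp b sF) iF1.
Qed.

Lemma cascade_sub F c : subsystem F -> kostant_cascade P F c -> F c /\ P c.
Proof.
move=> + KFc; elim: KFc => {F c} [F b hb sF|F b F1 c hb iF1 _ IH sF].
  by split; [case: hb | exact: highest_root_pos hb].
have [F1c Pc] := IH (subsystem_component (subsystem_perp b sF) iF1).
by split=> //; case: iF1 => F1F _ _; case: (F1F _ F1c).
Qed.

Local Notation Kas := (kostant_cascade P Delta).

Lemma cascade_pos c : Kas c -> P c.
Proof. by move=> /(cascade_sub subsystem_root)[]. Qed.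

Lemma cascade_root c : Kas c -> Delta c.
Proof. by move=> /cascade_pos/pos_root. Qed.

(** In a given system the recursion has a single starting point, as the highest
    root is unique. *)
Lemma cascade_inv F b c : highest_root P F b -> kostant_cascade P F c ->
  c = b \/ exists2 F1, irreducible_component [set a | F a /\ cform a b = 0] F1 &
                       kostant_cascade P F1 c.
Proof.
move=> hb KFc; case: KFc hb => {F c} [F b' hb' hb|F b' F1 c hb' iF1 Kc hb].
  by left; exact: highest_root_uniq hb' hb.
by right; exists F1 => //; rewrite (highest_root_uniq hb hb').
Qed.

(** A cascade root that does not come from the recursion below the node F comes
    from a component orthogonal to it, or is the highest root of a system above
    F. *)
Lemma node_cascade F c : cascade_node F -> Kas c ->
  kostant_cascade P F c \/ forall x, F x -> cform x c = 0.
Proof.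
move=> nF Kc; elim: nF => {F} [|F b F1 nF IH hb iF1]; first by left.
have sF := node_subsystem nF; have [F1F _ _] := iF1.
have sFb := subsystem_perp b sF.
case: IH => [KFc|Fc0]; last by right=> x /F1F[Fx _]; apply: Fc0.
case: (cascade_inv hb KFc) => [->|[F2 iF2 KF2c]]; first by right=> x /F1F[].
case: (component_disjoint iF1 iF2) => [->|o12]; first by left.
right=> x F1x; apply: o12 => //.
by have [] := cascade_sub (subsystem_component sFb iF2) KF2c.
Qed.

(** Go down to the node whose highest root is c; by [node_cascade] the other root
    is orthogonal to this node or lies in the orthogonal complement of c. *)
Lemma cascade_orth c c' : Kas c -> Kas c' -> c != c' -> cform c c' = 0.
Proof.
suff H F : kostant_cascade P F c -> cascade_node F -> Kas c' -> c != c' ->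
    cform c c' = 0 by move=> Kc; apply: (H _ Kc); exact: node_top.
elim=> {F c} [F b hb nF Kc' bc'|F b F1 c hb iF1 _ IH nF]; last first.
  by apply: IH; apply: node_sub iF1.
case: (node_cascade nF Kc') => [KFc'|]; last by apply; case: hb.
case: (cascade_inv hb KFc') => [e|[F1 iF1 KF1]]; first by rewrite e eqxx in bc'.
have sFb := subsystem_perp b (node_subsystem nF).
have [F1F _ _] := iF1.
have [/F1F[_ c'b] _] := cascade_sub (subsystem_component sFb iF1) KF1.
by rewrite (cform_sym crys).
Qed.

(** * The product of the reflections in the cascade roots *)

Section Reflection.
Variable ks : seq V.
Hypothesis ksE : Kas = [set` ks].
Hypothesis ks_uniq : uniq ks.

(** As the cascade roots are pairwise orthogonal, the product of the reflections
    subtracts all the projections at once. *)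
Definition cascade_reflection x := x - \sum_(c <- ks) cn x c *: c.
Local Notation w := cascade_reflection.

Lemma mem_ks c : (c \in ks) <-> Kas c.
Proof. by rewrite ksE. Qed.

Lemma cform_cascade_sum s (f : V -> K) c : uniq s -> {subset s <= ks} -> Kas c ->
  cform (\sum_(d <- s) f d *: d) c = if c \in s then f c * cform c c else 0.
Proof.
move=> us sks Kc; rewrite cform_suml.
have z d : d \in s -> d != c -> cform (f d *: d) c = 0.
  move=> ds dc; rewrite cformZl cascade_orth ?mulr0 //.
  by apply/mem_ks/sks.
case: ifPn => cs.
  rewrite (bigD1_seq c) //= big_seq_cond big1 ?addr0 ?cformZl //.
  by move=> d /andP[]; exact: z.
rewrite big_seq big1 // => d ds; apply: z => //.
by apply: contraNneq cs => <-.
Qed.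

Lemma cascade_reflectionD x y : w (x + y) = w x + w y.
Proof.
rewrite /w addrACA -opprD -big_split /=; congr (_ - _).
by apply: eq_bigr => c _; rewrite cartan_numberD scalerDl.
Qed.

Lemma cform_cascade_reflection x c : Kas c -> cform (w x) c = - cform x c.
Proof.
move=> Kc; rewrite /w cformBl cform_cascade_sum // (mem_ks c).2 //.
rewrite /cn mulfVK ?cform_self_neq0 ?cascade_root //.
  by rewrite mulr_natl mulr2n opprD addNKr.
exact: cascade_root.
Qed.

Lemma cascade_reflectionK x : w (w x) = x.
Proof.
rewrite {1}/w (_ : \sum_(c <- ks) _ = - \sum_(c <- ks) cn x c *: c).
  by rewrite opprK /w subrK.
rewrite -sumrN; apply: eq_big_seq => c /mem_ks Kc.
by rewrite /cn cform_cascade_reflection // mulrN mulNr scaleNr.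
Qed.

(** A cascade root is in F, which is closed under its reflection, or is orthogonal
    to F. *)
Lemma node_reflection F x : cascade_node F -> F x -> F (w x).
Proof.
move=> nF Fx; have sF := node_subsystem nF; rewrite /w.
suff H s : uniq s -> {subset s <= ks} -> F (x - \sum_(c <- s) cn x c *: c).
  exact: H.
elim: s => [_ _|c s IH /= /andP[cs us] sks]; first by rewrite big_nil subr0.
have Kc : Kas c by apply/mem_ks/sks; rewrite mem_head.
have sks' : {subset s <= ks} by move=> d ds; apply: sks; rewrite inE ds orbT.
have Fy := IH us sks'; set y := x - _ in Fy.
have yc : cform y c = cform x c.
  by rewrite cformBl cform_cascade_sum // (negPf cs) subr0.
have -> : x - \sum_(d <- c :: s) cn x d *: d = y - cn y c *: c.
  by rewrite big_cons /cn yc opprD addrCA addrC.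
case: (node_cascade nF Kc) => [/(cascade_sub sF)[Fc _]|Fc].
  exact: subsystem_reflection.
by rewrite /cn (Fc _ Fy) mulr0 mul0r scale0r subr0.
Qed.

Variable theta : V.
Hypothesis hi : highest_root P Delta theta.

Lemma node_highest F : cascade_node F -> exists b, highest_root P F b.
Proof.
case=> [|{}F b F1 nF _ iF1]; first by exists theta.
apply: highest_root_exists; last by case: iF1.
exact: subsystem_component (subsystem_perp b (node_subsystem nF)) iF1.
Qed.

(** As long as x is orthogonal to the highest root of the node, x belongs to a
    component of its orthogonal complement, which is a smaller node. *)
Lemma node_catch x : Delta x ->
  exists F b, [/\ cascade_node F, highest_root P F b, F x & cform x b != 0].
Proof.
have [s sE] := (finite_seqP _).1 (roots_finite crys).
suff H F : cascade_node F -> F x ->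
  exists F b, [/\ cascade_node F, highest_root P F b, F x & cform x b != 0].
  by apply: H; exact: node_top.
have [n] := ubnP (count (fun d => `[< F d >]) s).
elim: n F => // n IH F; rewrite ltnS => leF nF Fx.
have [b hb] := node_highest nF; have [Fb _] := hb; have sF := node_subsystem nF.
case: (eqVneq (cform x b) 0) => [xb|xb]; last by exists F, b.
have [F1 iF1 F1x] := component_exists (subsystem_perp b sF) (conj Fx xb).
have [F1F _ _] := iF1; have Db := proj1 sF _ Fb.
apply: (IH F1) => //; last exact: node_sub iF1.
apply: leq_trans leF; apply: (count_lt (x := b)).
- by move=> y /asboolP/F1F[Fy _]; apply/asboolP.
- by have := Db; rewrite sE.
- exact/asboolP.
- apply/asboolP => /F1F[_ bb]; by have := cform_self_neq0 Db; rewrite bb eqxx.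
Qed.

Lemma node_cascade_sub F : cascade_node F -> kostant_cascade P F `<=` Kas.
Proof.
elim=> {F} // F b F1 _ IH hb iF1 c Kc; apply: IH.
exact: cascade_rec hb iF1 Kc.
Qed.

(** In the node F that catches x, positive roots have a nonnegative product with
    the highest root b, and w changes the sign of this product. *)
Lemma cascade_reflection_neg x : P x -> P (- w x).
Proof.
move=> Px; have [F [b [nF hb Fx xb]]] := node_catch (pos_root Px).
have sF := node_subsystem nF; have Fwx := node_reflection nF Fx.
have Kb : Kas b by apply: (node_cascade_sub nF); exact: cascade_highest.
case: (root_pos (proj1 sF _ Fwx)) => // Pwx.
have := highest_root_dominant sF hb Pwx Fwx.
rewrite (cform_sym crys) cform_cascade_reflection // oppr_ge0.
have := highest_root_dominant sF hb Px Fx; rewrite (cform_sym crys) => x0 x1.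
by case/negP: xb; rewrite eq_le x1 x0.
Qed.

(** * The simple root not orthogonal to the highest root *)

Variable alpha : V.
Hypothesis fund : fundamental_weight P theta.
Hypothesis simp : simple_root P alpha.
Hypothesis theta_alpha : cform theta alpha != 0.

Let Palpha : P alpha. Proof. by case: simp. Qed.
Let Dalpha : Delta alpha. Proof. exact: pos_root. Qed.
Let Dtheta : Delta theta. Proof. by case: hi. Qed.
Let Ktheta : Kas theta. Proof. exact: cascade_highest. Qed.

Lemma theta_dominant x : P x -> 0 <= cform theta x.
Proof. by move=> Px; apply: (highest_root_dominant subsystem_root hi) => //; exact: pos_root. Qed.

Lemma cform_theta_alpha_gt0 : 0 < cform theta alpha.
Proof. by rewrite lt0r theta_alpha theta_dominant. Qed.

Lemma cform_coroot x b : cform x (coroot b) = cn x b.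
Proof. by rewrite /coroot cformZr mulrAC. Qed.

Lemma fundamental_simple b : simple_root P b -> cform theta b != 0 ->
  b = alpha /\ cn theta b = 1.
Proof.
move: fund => [a sa fa].
have H c : simple_root P c -> cform theta c != 0 -> c = a.
  move=> sc; apply: contraNeq => /negPf ca.
  by rewrite -cartan_number_eq0 -?cform_coroot ?fa ?ca //; case: sc => /pos_root.
move=> sb tb; rewrite (H b) // (H alpha) //; split=> //.
by rewrite -cform_coroot fa // eqxx.
Qed.

(** -w is additive, involutive and preserves positivity, so -w alpha is simple; its
    product with theta is that of alpha. *)
Lemma cascade_reflection_alpha : w alpha = - alpha.
Proof.
apply: oppr_inj; rewrite opprK; apply: (proj1 (fundamental_simple _ _)).
  split; first exact: cascade_reflection_neg.
  move=> [b [c [Pb Pc wE]]]; case: simp => _; apply.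
  exists (- w b), (- w c); split; try exact: cascade_reflection_neg.
  rewrite -opprD -cascade_reflectionD -wE -[LHS]cascade_reflectionK.
  have wN x : w (- x) = - w x.
    apply/eqP; rewrite -addr_eq0 -cascade_reflectionD addNr.
    by rewrite -(subrr 0) /w big1 ?subr0 // => d _; rewrite /cn cform0l mulr0 mul0r scale0r.
  by rewrite wN opprK.
rewrite cformNr oppr_eq0 (cform_sym crys) cform_cascade_reflection //.
by rewrite oppr_eq0 (cform_sym crys).
Qed.

Lemma alpha_cascade_sum : alpha *+ 2 = \sum_(c <- ks) cn alpha c *: c.
Proof.
have := cascade_reflection_alpha; rewrite /w => /eqP.
by rewrite subr_eq addrC -subr_eq opprK => /eqP <-; rewrite mulr2n.
Qed.

(** Let m = n + 2 be the Cartan number.  The negative of the reflection of x in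
    theta is the root m theta - x, which is at most theta; so x - (m - 1) theta,
    and a fortiori x - theta, is a sum of positive roots.  The same holds for
    theta - x. *)
Lemma cartan_theta x (n : nat) : Delta x -> cn x theta = n.+2%:R -> x = theta.
Proof.
move=> Dx cx; have [_ hic] := hi.
have le y : Delta y -> cone P (theta - y).
  by move=> /hic; exact: cone_posI.
have Ptheta := highest_root_pos subsystem_root hi.
have Ds : Delta (- (x - cn x theta *: theta)).
  by apply: root_opp => //; exact: root_reflection.
apply/eqP; rewrite -subr_eq0; apply/eqP/cone_antisym; last by rewrite opprB; exact: le.
have := coneD (le _ Ds) (coneMn n (cone1 Ptheta)).
rewrite opprK cx scaler_nat; congr (cone P _).
by rewrite !mulrS !opprD !addrA [theta + x]addrC addrK addrNK.
Qed.

(** This Cartan number is positive, and if it exceeded 1, alpha would be theta, so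
    that <theta, alpha^vee> would be 2 and not 1. *)
Lemma cartan_alpha_theta : cn alpha theta = 1.
Proof.
have [n e] := cartan_number_int Dtheta Dalpha.
have ne : 0 < cn alpha theta.
  by rewrite cartan_number_gt0 // (cform_sym crys) cform_theta_alpha_gt0.
move: ne; rewrite e ltr0z; case: n e => // -[//|[//|n]] e _.
have := proj2 (fundamental_simple simp theta_alpha).
rewrite (cartan_theta Dalpha e) cartan_numberxx // => /eqP.
by rewrite -subr_eq0 -[2]/(1 + 1) addrK oner_eq0.
Qed.

(** First, (c, alpha) < 0: otherwise alpha - c or c - alpha is a positive root; the
    former contradicts the simplicity of alpha, the latter has a negative product
    with theta.  So c + k alpha is a root, with k = - <c, alpha^vee> > 0, and its
    Cartan number with respect to theta is k.  If k > 1, then c + k alpha = theta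
    by [cartan_theta]; applying <., alpha^vee> gives 1 = - k + 2 k. *)
Lemma cartan_cascade_alpha c : Kas c -> c != theta -> cform alpha c != 0 ->
  cn c alpha = -1.
Proof.
move=> Kc ct ac; have Pc := cascade_pos Kc; have Dc := pos_root Pc.
have ct0 : cform c theta = 0 by exact: cascade_orth.
have ac0 : cform c alpha < 0.
  rewrite real_ltNge ?real0 ?cform_real //; apply/negP => ca0.
  have {ca0}ac0 : 0 < cform alpha c by rewrite lt0r ac (cform_sym crys) ca0.
  case: (root_sub Dc Dalpha ac0) => [Dac|e]; last first.
    by case/negP: theta_alpha; rewrite (cform_sym crys) e ct0.
  case: (root_pos Dac) => Pac.
    by case: simp => _; apply; exists (alpha - c), c; split=> //; rewrite subrK.
  rewrite opprB in Pac; have := theta_dominant Pac.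
  rewrite cformDr cformNr (cform_sym crys) ct0 add0r oppr_ge0.
  by move=> /(lt_le_trans cform_theta_alpha_gt0); rewrite ltxx.
have [n e] := cartan_number_int Dalpha Dc.
have : cn c alpha < 0.
  by rewrite -oppr_gt0 -mulNr -mulrN -cformNl [_ / _]/(cn _ _) cartan_number_gt0 // cformNl oppr_gt0.
rewrite e ltrz0; case: n e => // -[//|n] e _; exfalso.
have Dr := root_reflection Dalpha Dc; set r := c - _ in Dr.
have rt : cn r theta = n.+2%:R.
  rewrite /r -scaleNr cartan_numberD cartan_numberZ cartan_alpha_theta mulr1.
  by rewrite e {1}/cn ct0 mulr0 mul0r add0r NegzE mulrNz opprK.
have [_ ] := fundamental_simple simp theta_alpha.
rewrite -(cartan_theta Dr rt) /r -scaleNr cartan_numberD cartan_numberZ.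
rewrite cartan_numberxx // e NegzE mulrNz opprK mulr_natr mulr2n addKr => /eqP.
by rewrite -[1]/(1%:R) -pmulrn eqr_nat.
Qed.

(** Apply <., alpha^vee> to [alpha_cascade_sum]: 2 * 2 = 1 * 1 - S, where S is the
    part of the sum without theta. *)
Lemma sum_cartan_alpha : \sum_(c <- ks) cn alpha c = - 2.
Proof.
have kt : theta \in ks by apply/mem_ks.
have : cn (alpha *+ 2) alpha = \sum_(c <- ks) cn alpha c * cn c alpha.
  rewrite alpha_cascade_sum; elim: (ks) => [|c s IH].
    by rewrite !big_nil /cn cform0l mulr0 mul0r.
  by rewrite !big_cons cartan_numberD cartan_numberZ IH.
rewrite mulr2n cartan_numberD cartan_numberxx // !(bigD1_seq theta) //=.
rewrite cartan_alpha_theta (proj2 (fundamental_simple simp theta_alpha)) mulr1.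
rewrite [in X in _ = X -> _]big_seq_cond [in X in _ -> X]big_seq_cond.
have -> : \sum_(c <- ks | (c \in ks) && (c != theta)) cn alpha c * cn c alpha =
          - \sum_(c <- ks | (c \in ks) && (c != theta)) cn alpha c.
  rewrite -sumrN; apply: eq_bigr => c /andP[/mem_ks Kc ct].
  case: (eqVneq (cform alpha c) 0) => ac; last first.
    by rewrite cartan_cascade_alpha // mulrN1.
  by rewrite {1 3}/cn ac mulr0 !mul0r oppr0.
set S := \sum_(_ <- _ | _) _ => e.
rewrite -[S]opprK -[- S](addKr 1) -e; ring.
Qed.

Lemma cascade_coordinate x :
  cform x (\sum_(c \in Kas) (cform c c)^-1 *: c) = 2^-1 * \sum_(c <- ks) cn x c.
Proof.
rewrite ksE -fsbig_seq // (cform_sym crys) cform_suml mulr_sumr.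
apply: eq_bigr => c _.
by rewrite cformZl (cform_sym crys) /cn -mulrA mulKf ?pnatr_eq0 // mulrC.
Qed.

Lemma cform_alpha_cascade :
  cform alpha (\sum_(c \in Kas) (cform c c)^-1 *: c) = -1.
Proof. by rewrite cascade_coordinate sum_cartan_alpha mulrN mulVf ?pnatr_eq0. Qed.

Lemma cform_theta_cascade :
  cform theta (\sum_(c \in Kas) (cform c c)^-1 *: c) = 1.
Proof.
have kt : theta \in ks by apply/mem_ks.
rewrite cascade_coordinate (bigD1_seq theta) //= big_seq_cond big1 => [|c].
  by rewrite addr0 cartan_numberxx // mulVf ?pnatr_eq0.
move=> /andP[/mem_ks Kc ct].
by rewrite /cn (cform_sym crys) cascade_orth // mulr0 mul0r.
Qed.

End Reflection.
End Positive.
End RootSystem.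

Lemma cascade_values (K : numFieldType) (g : lieAlgType K) (t : {vspace g})
    (P : set 'Hom(subvs_of t, K^o)) (theta alpha : 'Hom(subvs_of t, K^o)) :
  lie_simple g -> cartan_subalgebra t -> positive_system P ->
  highest_root P (root_system t) theta ->
  fundamental_weight P theta ->
  simple_root P alpha -> cform theta alpha != 0 ->
  (alpha (cascade_element P) : K) = -1 /\ (theta (cascade_element P) : K) = 1.
Proof.
move=> simple cartan posP hi fund simp ta.
have [e [lam wB]] := weight_basis_exists cartan.
have crys := root_system_crystallographic cartan wB simple.
have [ks ksE ksU] : exists2 ks : seq 'Hom(subvs_of t, K^o),
    kostant_cascade P (root_system t) = [set` ks] & uniq ks.
  have [|s sE] := (finite_seqP (kostant_cascade P (root_system t))).1.
    apply: sub_finite_set (roots_finite crys) => c.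
    exact: cascade_root.
  exists (undup s); last exact: undup_uniq.
  by rewrite sE; apply/seteqP; split=> c /=; rewrite mem_undup.
rewrite -!(cformE cartan wB simple).
split; first exact: (cform_alpha_cascade crys posP ksE ksU hi fund simp ta).
exact: (cform_theta_cascade crys posP ksE ksU hi).
Qed.

Theorem lemma3p1 (R : realType) (g : lieAlgType R[i]) (t : {vspace g})
    (P : set 'Hom(subvs_of t, R[i]^o))
    (theta alpha : 'Hom(subvs_of t, R[i]^o)) :
  lie_simple g -> cartan_subalgebra t -> positive_system P ->
  highest_root P (root_system t) theta ->
  fundamental_weight P theta ->
  simple_root P alpha -> cform theta alpha != 0 ->
  [/\ (alpha (cascade_element P) : R[i]) = -1,
      ((theta - alpha) (cascade_element P) : R[i]) = 2
    & ~ dominant P (cascade_element P)].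
Proof.
move=> simple cartan posP hi fund simp ta.
have [ax tx] := cascade_values simple cartan posP hi fund simp ta.
split; first exact: ax.
  by rewrite add_lfunE opp_lfunE ax tx opprK.
by move=> /(_ alpha (proj1 simp)); rewrite ax oppr_ge0 ler10.
Qed.
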